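(* Let $n,m\geq1$ and let $(S_1,\dots,S_{n+m})$ be an exchangeable random vector of real scores with almost surely no ties. Let $p_i=\frac1{n+1}\big(1+\sum_{j=1}^n\mathbf{1}\{S_j\geq S_{n+i}\}\big)$, $i\in\{1,\dots,m\}$, and $\widehat F_m(t)=m^{-1}\sum_{i=1}^m\mathbf{1}\{p_i\leq t\}$. Let $\mathcal K\subset\{1,\dots,m\}$ and let $(t_k(\lambda))_{\lambda\in[0,1],k\in\mathcal K}$ be a template, i.e. for each $k\in\mathcal K$, $t_k(0)=0$ and $t_k(\cdot)$ is continuous and increasing on $[0,1]$. For $\delta\in(0,1)$ let $$\lambda(\delta,n,m)=\max\Big\{\lambda\in\Lambda:\mathbb{P}_{\boldsymbol p\sim P_{n,m}}\Big(\min_{k\in\mathcal K}t_k^{-1}(p_{(k)})>\lambda\Big)\geq1-\delta\Big\},$$ where $\Lambda=\{t_k^{-1}(\ell/(n+1)):k\in\mathcal K,\ell\in\{1,\dots,n+1\}\}$ and $p_{(1)}\leq\dots\leq p_{(m)}$ are the order statistics of $\boldsymbol p$. Then $$\mathbb{P}\Big(\forall k\in\mathcal K:\ \widehat F_m\big(t_k(\lambda(\delta,n,m))\big)\leq\frac km\Big)\geq1-\delta.$$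
   Context: $P_{n,m}$: distribution of $(q_1,\dots,q_m)$ where $U_1,\dots,U_n$ i.i.d. $\mathrm{Unif}[0,1]$ and, given $U$, $q_1,\dots,q_m$ i.i.d. with distribution $P^U$ on $\{\ell/(n+1):\ell\leq n+1\}$ assigning mass $U_{(\ell)}-U_{(\ell-1)}$ to $\ell/(n+1)$ (with $U_{(1)}\leq\dots\leq U_{(n)}$ the order statistics, $U_{(0)}=0$, $U_{(n+1)}=1$). Here $t_k^{-1}(x):=\sup\{\lambda\in[0,1]:t_k(\lambda)\leq x\}$ for $x\geq0$, and $\lambda(\delta,n,m):=0$ if the set in its definition is empty. *)

(* Defs.v *)
From HB Require Import structures.
From mathcomp Require Import all_boot all_order all_algebra all_fingroup.
From mathcomp Require Import all_classical all_reals all_analysis.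
Set Implicit Arguments. Unset Strict Implicit. Unset Printing Implicit Defensive.
Import Order.TTheory GRing.Theory Num.Theory.
Import numFieldNormedType.Exports.
Local Open Scope classical_set_scope.
Local Open Scope ring_scope.

Section Defs.
Variable R : realType.

Definition ordstat (N : nat) (q : 'I_N -> R) (k : nat) : R :=
  nth 0 (sort <=%R [seq q i | i <- enum 'I_N]) k.-1.

Definition tinv (t : R -> R) (x : R) : R :=
  sup [set l | 0 <= l <= 1 /\ t l <= x].

(* conformal p-value p_i, i : 'I_m (index i stands for i+1 in the paper) *)
Definition pval (n m : nat) (s : 'I_(n + m) -> R) (i : 'I_m) : R :=
  (1 + (#|[set j : 'I_n | s (rshift n i) <= s (lshift m j)]|)%:R) / (n.+1)%:R.

Definition Fhat (n m : nat) (s : 'I_(n + m) -> R) (x : R) : R :=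
  (#|[set i : 'I_m | pval s i <= x]|)%:R / m%:R.

Definition ustat (n : nat) (u : 'I_n -> R) (l : nat) : R :=
  if l == 0%N then 0 else if l == n.+1 then 1 else ordstat u l.

(* P^U(l/(n+1)) = U_(l) - U_(l-1), for l = 1..n+1 *)
Definition PUmass (n : nat) (u : 'I_n -> R) (l : nat) : R :=
  ustat u l - ustat u l.-1.

(* conditional probability, given U = u, that (q_1..q_m) i.i.d. ~ P^U lies in E.
   a : 'I_m -> 'I_n.+1 encodes q_i = (a i + 1)/(n+1). *)
Definition condprob (n m : nat) (u : 'I_n -> R) (E : ('I_m -> R) -> Prop) : R :=
  \sum_(a : {ffun 'I_m -> 'I_n.+1})
     (\prod_(i : 'I_m) PUmass u (a i).+1) *
     (if `[< E (fun i => (a i).+1%:R / (n.+1)%:R) >] then 1 else 0).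

(* Iterated integral over [0,1]^k of f with respect to Lebesgue measure,
   i.e. expectation of f(U_0,...,U_{k-1}) for U_j i.i.d. Unif[0,1]
   (coordinates >= k are irrelevant / set to 0). *)
Fixpoint iint (k : nat) (f : (nat -> R) -> R) : R :=
  match k with
  | 0%N => f (fun _ => 0)
  | k'.+1 => Rintegral (@lebesgue_measure R) `[0%R, 1%R]
      (fun x => iint k' (fun v => f (fun j => if j == k' then x else v j)))
  end.

Definition Pnm (n m : nat) (E : ('I_m -> R) -> Prop) : R :=
  iint n (fun v => condprob (fun i : 'I_n => v (nat_of_ord i)) E).

(* the event { min_{k in K} t_k^{-1}(p_(k)) > lam } (k : 'I_m.+1 stands for k) *)
Definition minevent (m : nat) (K : {set 'I_m.+1}) (t : 'I_m.+1 -> R -> R)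
  (lam : R) (q : 'I_m -> R) : Prop :=
  forall k, k \in K -> lam < tinv (t k) (ordstat q k).

Definition Lambda (n m : nat) (K : {set 'I_m.+1}) (t : 'I_m.+1 -> R -> R) : set R :=
  [set x | exists k, exists l : nat, k \in K /\ (1 <= l <= n.+1)%N /\
           x = tinv (t k) (l%:R / (n.+1)%:R)].

(* lambda(delta,n,m): max of a finite set (= its sup), 0 if the set is empty *)
Definition lamsel (n m : nat) (K : {set 'I_m.+1}) (t : 'I_m.+1 -> R -> R)
  (delta : R) : R :=
  let A := [set x | Lambda n K t x /\ 1 - delta <= Pnm n (minevent K t x)] in
  if `[< A !=set0 >] then sup A else 0.

Definition template_fun (f : R -> R) : Prop :=
  [/\ f 0 = 0, {within `[0%R, 1%R], continuous f}
    & {in `[0%R, 1%R] &, forall x y, x < y -> f x < f y}].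

End Defs.

(* Main.v *)
(** Write [a i] for the number of calibration scores above the test score [i],
    and [c_l] for the number of tests [i] with [a i = l]; the p-value of [i] is
    [(a i + 1) / (n + 1)].

    - Exchangeability and the absence of ties make all [(n + m)!] rankings of
      the scores equally likely. Read a ranking from the top, recording [l] for
      a test score of level [l] and a blank for a calibration score: all the
      rankings that produce [a] spell the same word, so that there are
      [n! * prod_l c_l!] of them.
    - Under [P_{n,m}], [a] has probability
      [E prod_l (U_(l+1) - U_(l))^c_l = n! * prod_l c_l! / (n + m)!]. Integrating
      out the innermost variable merges two adjacent gaps by a beta integral, so
      this Dirichlet integral follows by induction without Fubini's theorem.

    Hence the conformal p-values are distributed according to [P_{n,m}]. When
    [min_k t_k^-1(p_(k)) > lambda], we have [t_k(lambda) < p_(k)], so fewer than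
    [k] p-values are at most [t_k(lambda)]. *)
Require Import Defs.
From HB Require Import structures.
From mathcomp Require Import all_boot all_order all_algebra all_fingroup.
From mathcomp Require Import all_classical all_reals all_analysis.
From mathcomp Require Import measurable_realfun.
From mathcomp Require Import ring.
Set Implicit Arguments. Unset Strict Implicit. Unset Printing Implicit Defensive.
Import Order.TTheory GRing.Theory Num.Theory.
Import numFieldNormedType.Exports.
Local Open Scope classical_set_scope.
Local Open Scope ring_scope.

Lemma sort_cons (d : Order.disp_t) (T : orderType d) (x : T) s :
  sort <=%O (x :: s) = merge <=%O [:: x] (sort <=%O s).
Proof.
apply: (sorted_eq le_trans le_anti).
- exact: sort_le_sorted.
- by apply: merge_sorted => //; [exact: le_total|exact: sort_le_sorted].
by rewrite perm_sort perm_sym perm_merge perm_cons perm_sort.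
Qed.

Lemma sorted_gt_uniq_ge (d : Order.disp_t) (T : orderType d) (X : Type)
    (f : X -> T) s :
  sorted (fun x y => f y < f x)%O s =
  uniq (map f s) && sorted (fun x y => f y <= f x)%O s.
Proof. by have := @lt_sorted_uniq_le _ T^d (map f s); rewrite !sorted_map. Qed.

Lemma count_permutations_map (X : eqType) (Y : finType) (f : X -> Y) s w :
  uniq s -> perm_eq (map f s) w ->
  count (fun u => map f u == w) (permutations s) =
  (\prod_y (count_mem y w)`!)%N.
Proof.
elim: w s => [|y w IH] s us sw.
  by move/perm_size: sw; rewrite size_map => /size0nil -> /=; rewrite big1.
have s_gt0 : (0 < size s)%N by rewrite -(size_map f) (perm_size sw).
rewrite (seq.permP (permutationsE s_gt0)) undup_id// count_flatten -map_comp.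
rewrite sumnE big_map.
transitivity (\sum_(x <- s | f x == y) \prod_z (count_mem z w)`!)%N.
  rewrite [RHS]big_mkcond; apply: eq_big_seq => x xs /=; rewrite count_map.
  have [fxy|/negbTE fxy] := eqVneq (f x) y; last first.
    rewrite -[RHS](count_pred0 (permutations (rem x s))).
    by apply: eq_count => u; rewrite /= eqseq_cons fxy.
  rewrite -(IH (rem x s)) ?rem_uniq//.
    by apply: eq_count => u; rewrite /= eqseq_cons fxy eqxx.
  rewrite -(perm_cons y); apply: perm_trans sw.
  by rewrite -fxy -map_cons perm_sym perm_map// perm_to_rem.
rewrite big_const_seq iter_addn_0 mulnC.
have -> : count (fun x => f x == y) s = (count_mem y w).+1.
  by rewrite -[LHS](count_map f (pred1 y)) (seq.permP sw) /= eqxx.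
rewrite (bigD1 y)//= [RHS](bigD1 y)//= eqxx add1n factS -mulnA.
by congr (_ * (_ * _))%N; apply: eq_bigr => z /negbTE zy; rewrite eq_sym zy.
Qed.

Lemma count_take_index_decreasing (d : Order.disp_t) (T : orderType d)
    (X : eqType) (f : X -> T) (p : pred X) s x :
  sorted (fun y z => f z <= f y)%O s -> x \in s -> ~~ p x ->
  (forall y, p y -> f y != f x) ->
  count p (take (index x s) s) = count [pred y | p y & (f x <= f y)%O] s.
Proof.
move=> s_decr xs px f_neq; case: {xs}(path.splitP xs) s_decr => s1 s2.
have ge_tr : transitive (fun y z => f z <= f y)%O.
  by move=> y z u yz uy; apply: le_trans uy yz.
rewrite cat_rcons sorted_pairwise// pairwise_cat allrel_consr /= -andbA.
move=> /and5P[/allP above _ _ /allP below _].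
rewrite count_cat /= (negbTE px) add0n -[LHS]addn0; congr (_ + _)%N.
  by apply: eq_in_count => y /(above _) xy /=; rewrite xy andbT.
rewrite -[LHS](count_pred0 s2); apply: eq_in_count => y /(below _) yx /=.
by apply/esym/andP => -[/f_neq/eqP fyx xy]; apply/fyx/le_anti; rewrite yx.
Qed.

Section LeveledWords.
Context {k : nat}.
Implicit Types (w : seq (option 'I_k)) (x : option 'I_k).

(* A ranking is read from the top as a word: [None] is a calibration score and
   [Some l] a test score, whose level [l] must count the calibration scores
   read before it. *)
Definition leveled w :=
  forall u l v, w = u ++ Some l :: v -> l = count_mem None u :> nat.

Lemma leveled_rconsl w x : leveled (rcons w x) -> leveled w.
Proof.
by move=> lwx u l v wE; apply: (lwx u l (rcons v x)); rewrite wE rcons_cat.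
Qed.

Lemma leveled_last w l : leveled (rcons w (Some l)) ->
  l = count_mem None (rcons w (Some l)) :> nat.
Proof.
move=> lw; rewrite -cats1 count_cat /= !addn0.
by apply: (lw w l [::]); rewrite cats1.
Qed.

Lemma leveled_le w l : leveled w -> Some l \in w -> (l <= count_mem None w)%N.
Proof.
move=> + /splitPr ww; case: ww => u v /(_ u l v erefl) ->.
by rewrite count_cat leq_addr.
Qed.

Lemma leveled_last_neq w w' l :
  leveled (rcons w None) -> leveled (rcons w' (Some l)) ->
  ~~ perm_eq (rcons w None) (rcons w' (Some l)).
Proof.
move=> lw /leveled_last lE; apply/negP => ww'.
have l_succ : l = (count_mem None w).+1 :> nat.
  by rewrite lE -(seq.permP ww') -cats1 count_cat /= addn0 addn1.
have : Some l \in rcons w None by rewrite (perm_mem ww') mem_rcons mem_head.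
rewrite mem_rcons inE /= => /(leveled_le (leveled_rconsl lw)).
by rewrite l_succ ltnn.
Qed.

Lemma perm_leveled w w' : perm_eq w w' -> leveled w -> leveled w' -> w = w'.
Proof.
elim/last_ind: w w' => [|w x IH] w'; case/lastP: w' => [|w' x'] //.
- by move/perm_size; rewrite size_rcons.
- by move/perm_size; rewrite size_rcons.
move=> ww' lw lw'; suff xx' : x = x'.
  move: ww' lw' lw; rewrite xx' -!cats1 perm_cat2r !cats1.
  by move=> /IH ww' /leveled_rconsl/ww' {}ww' /leveled_rconsl/ww' ->.
case: x x' ww' lw lw' => [l|] [l'|] // ww' lw lw'.
- congr Some; apply: val_inj.
  by rewrite /= (leveled_last lw) (seq.permP ww') -leveled_last.
- by have := leveled_last_neq lw' lw; rewrite perm_sym ww'.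
- by have := leveled_last_neq lw lw'; rewrite ww'.
Qed.

End LeveledWords.

Definition rankings N : seq (seq 'I_N) := permutations (enum 'I_N).

Lemma perm_rankings N (s u : seq 'I_N) :
  s \in rankings N -> u \in rankings N -> perm_eq s u.
Proof. by rewrite !mem_permutations => /permPl -> uN; rewrite perm_sym. Qed.

Lemma mem_ranking N (s : seq 'I_N) x : s \in rankings N -> x \in s.
Proof. by rewrite mem_permutations => /perm_mem ->; rewrite mem_enum. Qed.

Lemma ranking_uniq N (s : seq 'I_N) : s \in rankings N -> uniq s.
Proof. by rewrite mem_permutations => /perm_uniq ->; rewrite enum_uniq. Qed.

Lemma decreasing_ranking_inj N (d : Order.disp_t) (T : orderType d)
    (x : 'I_N -> T) s :
  s \in rankings N -> sorted (fun i j => x j < x i)%O s -> injective x.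
Proof.
rewrite mem_permutations (sorted_gt_uniq_ge x) => s_perm /andP[x_uniq _].
apply/injectiveP; rewrite /injectiveb /dinjectiveb.
by rewrite -(perm_uniq (perm_map x s_perm)).
Qed.

Section RankingLevels.
Context {n m : nat}.
Implicit Types (s : seq 'I_(n + m)) (a : {ffun 'I_m -> 'I_n.+1}).

Definition calibration : pred 'I_(n + m) := [pred x : 'I_(n + m) | (x < n)%N].

Definition ranking_levels s : {ffun 'I_m -> 'I_n.+1} :=
  [ffun i => inord (count calibration (take (index (rshift n i) s) s))].

Definition label a (x : 'I_(n + m)) : option 'I_n.+1 :=
  if fintype.split x is inr i then Some (a i) else None.

Lemma calibration_lshift i : calibration (lshift m i).
Proof. by rewrite /calibration /= ltn_ord. Qed.

Lemma calibration_rshift i : calibration (rshift n i) = false.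
Proof. by rewrite /calibration /= ltnNge leq_addr. Qed.

Lemma label_lshift a i : label a (lshift m i) = None.
Proof. by rewrite /label (unsplitK (inl i)). Qed.

Lemma label_rshift a i : label a (rshift n i) = Some (a i).
Proof. by rewrite /label (unsplitK (inr i)). Qed.

Lemma label_eq_None a x : (label a x == None) = calibration x.
Proof.
by case: (split_ordP x) => i ->;
  rewrite (label_lshift, label_rshift) (calibration_lshift, calibration_rshift).
Qed.

Lemma count_mem_None_label a s :
  count_mem None (map (label a) s) = count calibration s.
Proof.
by rewrite count_map; apply: eq_count => x; rewrite /= label_eq_None.
Qed.

Lemma count_enum_lrshift (p : pred 'I_(n + m)) :
  count p (enum 'I_(n + m)) =
  (#|[pred i | p (lshift m i)]| + #|[pred i | p (rshift n i)]|)%N.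
Proof.
rewrite -sum1_count big_mkcond big_enum /= big_split_ord /=.
by rewrite -!big_mkcond !sum1_card.
Qed.

Lemma count_calibration : count calibration (enum 'I_(n + m)) = n.
Proof.
rewrite count_enum_lrshift (eq_card (B := predT)) ?card_ord; last first.
  by move=> i; rewrite !inE calibration_lshift.
rewrite [X in (_ + X)%N]eq_card0 ?addn0// => i.
by rewrite !inE calibration_rshift.
Qed.

Lemma ranking_levelsE s i : s \in rankings (n + m) ->
  ranking_levels s i = count calibration (take (index (rshift n i) s) s) :> nat.
Proof.
rewrite mem_permutations ffunE => /seq.permP s_perm; apply: inordK.
rewrite ltnS -[leqRHS]count_calibration -s_perm.
exact/leq_count_subseq/take_subseq.
Qed.

Lemma ranking_levels_decreasing (d : Order.disp_t) (T : orderType d)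
    (f : 'I_(n + m) -> T) s i :
  s \in rankings (n + m) -> sorted (fun x y => f y <= f x)%O s ->
  (forall j, f (lshift m j) != f (rshift n i)) ->
  ranking_levels s i =
  #|[pred j | (f (rshift n i) <= f (lshift m j))%O]| :> nat.
Proof.
move=> s_rank s_decr f_neq; rewrite ranking_levelsE//.
rewrite (count_take_index_decreasing s_decr) ?mem_ranking//; first last.
- by move=> x; case: (split_ordP x) => j -> //; rewrite calibration_rshift.
- by rewrite calibration_rshift.
move: s_rank; rewrite mem_permutations => /seq.permP ->.
rewrite count_enum_lrshift [X in (_ + X)%N]eq_card0 ?addn0 => [|j]; last first.
  by rewrite !inE calibration_rshift.
by apply: eq_card => j; rewrite !inE calibration_lshift.
Qed.

Lemma ranking_levels_surj a :
  exists2 s, s \in rankings (n + m) & ranking_levels s = a.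
Proof.
(* Calibration scores are even and test scores odd, so that they never tie. *)
pose score (x : 'I_(n + m)) :=
  match fintype.split x with inl j => (n - j).*2 | inr i => (n - a i).*2.+1 end.
have scoreL j : score (lshift m j) = (n - j).*2.
  by rewrite /score (unsplitK (inl j)).
have scoreR i : score (rshift n i) = (n - a i).*2.+1.
  by rewrite /score (unsplitK (inr i)).
pose s := sort (fun x y => score y <= score x)%O (enum 'I_(n + m)).
have s_rank : s \in rankings (n + m) by rewrite mem_permutations perm_sort.
exists s => //; apply/ffunP => i; apply/val_inj => /=.
rewrite (ranking_levels_decreasing s_rank (f := score)); first last.
- move=> j; rewrite scoreL scoreR; apply/eqP => /(congr1 odd).
  by rewrite /= !odd_double.
- by apply: sort_sorted => x y; apply: le_total.
transitivity (\sum_(j < n | (j < a i)%N) 1)%N.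
  rewrite sum1_card; apply: eq_card => j; rewrite !inE scoreL scoreR leEnat.
  by rewrite ltn_double ltn_sub2lE// -ltnS.
by rewrite -(big_ord_widen n (fun=> 1%N)) ?sum1_card ?card_ord// -ltnS.
Qed.

Lemma ranking_levels_leveled s a : s \in rankings (n + m) ->
  ranking_levels s = a <-> leveled (map (label a) s).
Proof.
move=> s_rank; split=> [<- u l v sE|s_lev]; last first.
  apply/ffunP => i; apply/val_inj; rewrite /= ranking_levelsE//.
  case: (path.splitP (mem_ranking (rshift n i) s_rank)) s_lev => s1 s2 s_lev.
  rewrite -(count_mem_None_label a); apply/esym/(s_lev _ _ (map (label a) s2)).
  by rewrite map_cat map_rcons label_rshift cat_rcons.
have := congr1 (take (size u)) sE; have := congr1 (drop (size u)) sE.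
rewrite drop_size_cat// take_size_cat// -map_take -map_drop.
have := cat_take_drop (size u) s; move: (take _ s) => s1.
case: (drop _ s) => [//|x s2] s_cat /= [lx _] <-.
case: (split_ordP x) lx s_cat => i ->; first by rewrite label_lshift.
rewrite label_rshift => -[<-] s_cat.
rewrite ranking_levelsE// count_mem_None_label.
move: (ranking_uniq s_rank); rewrite -s_cat cat_uniq /= negb_or.
move=> /and3P[_ /andP[/negbTE i_s1 _] _].
by rewrite index_cat i_s1 /= eqxx addn0 take_size_cat.
Qed.

Lemma count_ranking_levels a :
  count (fun s => ranking_levels s == a) (rankings (n + m)) =
  (n`! * \prod_(l < n.+1) #|[pred i | a i == l]| `!)%N.
Proof.
have [s_a s_a_rank s_aE] := ranking_levels_surj a.
have s_a_perm : perm_eq s_a (enum 'I_(n + m)) by rewrite -mem_permutations.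
transitivity
    (count (fun s => map (label a) s == map (label a) s_a) (rankings (n + m))).
  apply: eq_in_count => s s_rank; apply/eqP/eqP => [sE|s_word]; last first.
    apply/ranking_levels_leveled; rewrite // s_word.
    exact/ranking_levels_leveled.
  apply: perm_leveled; first exact/perm_map/perm_rankings.
    exact/ranking_levels_leveled.
  exact/ranking_levels_leveled.
rewrite count_permutations_map ?enum_uniq//; last first.
  by rewrite perm_sym; apply: perm_map.
rewrite (bigD1 None)//= count_mem_None_label (seq.permP s_a_perm).
rewrite count_calibration; congr (_ * _)%N.
rewrite (reindex_omap Some id) => [|[]//].
rewrite (eq_bigl predT) => [|l]; last by rewrite /= eqxx.
apply: eq_bigr => l _; congr _`!.
rewrite count_map (seq.permP s_a_perm) count_enum_lrshift.
rewrite eq_card0 ?add0n => [|i]; last by rewrite !inE label_lshift.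
by apply: eq_card => i; rewrite !inE label_rshift.
Qed.

End RankingLevels.

Section HasRintegral.
Context {d : measure_display} {T : measurableType d} {R : realType}.
Context (mu : {measure set T -> \bar R}) (D : set T).
Hypothesis mD : measurable D.
Implicit Types (f g : T -> R) (v w : R).

Definition has_Rintegral f v : Prop :=
  mu.-integrable D (EFin \o f) /\ \int[mu]_(x in D) f x = v.

Lemma has_Rintegral_ext f g v :
  {in D, f =1 g} -> has_Rintegral f v -> has_Rintegral g v.
Proof.
move=> fg [fi <-]; split; last by apply: eq_Rintegral => x xD; rewrite fg.
by apply: eq_integrable fi => // x xD /=; rewrite fg.
Qed.

Lemma has_Rintegral0 : has_Rintegral (fun=> 0) 0.
Proof. by split; [exact: integrable0|rewrite Rintegral_cst// mul0r]. Qed.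

Lemma has_RintegralZ k f v :
  has_Rintegral f v -> has_Rintegral (fun x => k * f x) (k * v).
Proof.
move=> [fi <-]; split; last by rewrite RintegralZl.
rewrite (_ : _ \o _ = fun x => (k%:E * (EFin \o f) x)%E); last exact/funext.
exact: integrableZl.
Qed.

Lemma has_RintegralD f g v w : has_Rintegral f v -> has_Rintegral g w ->
  has_Rintegral (fun x => f x + g x) (v + w).
Proof.
move=> [fi <-] [gi <-]; split; last by rewrite RintegralD.
rewrite (_ : _ \o _ = (EFin \o f) \+ (EFin \o g))%E; last exact/funext.
exact: integrableD.
Qed.

End HasRintegral.

Section HasRintegralInterval.
Context {R : realType}.
Implicit Types (a b c v w : R) (f : R -> R).
Local Notation mu := (@lebesgue_measure R).

Lemma has_Rintegral_itv_cat a b c f v w : a <= b -> b <= c ->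
  has_Rintegral mu `[a, b] f v -> has_Rintegral mu `[b, c] f w ->
  has_Rintegral mu `[a, c] f (v + w).
Proof.
move=> ab bc [fi <-] [gi <-].
have acE : `[a, c]%classic = `[a, b]%classic `|` `]b, c]%classic :> set R.
  by rewrite -itv_bndbnd_setU// bnd_simp.
have {}gi : mu.-integrable `]b, c] (EFin \o f).
  by apply: integrableS gi => //; apply: subset_itvr; rewrite bnd_simp.
have disj : [disjoint `[a, b]%classic & `]b, c]%classic].
  apply/disj_setPS => y [/=]; rewrite !in_itv/= => /andP[_ yb] /andP[].
  by rewrite ltNge yb.
have fgi : mu.-integrable `[a, c] (EFin \o f).
  move/integrableP : fi => [mf fi]; move/integrableP : gi => [mg gi].
  apply/integrableP; rewrite acE; split; first exact/measurable_funU.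
  rewrite ge0_integral_setU//; first exact: lte_add_pinfty.
  by apply/measurable_funU => //; split; apply: measurableT_comp.
split => //; rewrite acE Rintegral_setU//; last by rewrite -acE.
by rewrite Rintegral_itv_obnd_cbnd.
Qed.

Lemma integrable_continuous_itv a b f :
  continuous f -> mu.-integrable `[a, b] (EFin \o f).
Proof.
move=> f_cont; apply: continuous_compact_integrable.
  exact: segment_compact.
exact: continuous_subspaceT.
Qed.

Lemma Rintegral_affine a b f : a < b -> continuous f ->
  \int[mu]_(x in `[a, b]) f ((x - a) / (b - a)) =
  (b - a) * \int[mu]_(x in `[0, 1]) f x.
Proof.
move=> ab f_cont; have ba0 : b - a != 0 by rewrite subr_eq0 gt_eqF.
pose F : {poly R} := (b - a)^-1%:P * ('X - a%:P).
have FE x : F.[x] = (x - a) / (b - a) by rewrite !hornerE mulrC.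
have F'E : (horner F)^`()%classic = cst (b - a)^-1.
  rewrite -derivE; apply/funext => x.
  by rewrite derivM derivC mul0r add0r derivB derivX derivC subr0 mulr1 hornerC.
have F_itv : `[F.[a], F.[b]] = `[0, 1] by rewrite !FE subrr mul0r divff.
rewrite -F_itv [in RHS]/Rintegral.
rewrite integration_by_substitution_increasing ?F'E; last 7 first.
- exact: ltW.
- by move=> x y _ _ xy; rewrite !FE ltr_pM2r ?invr_gt0 ?subr_gt0// ltrD2r.
- by move=> x _; apply: cst_continuous.
- exact: is_cvg_cst.
- exact: is_cvg_cst.
- split=> [x _||]; first exact: derivable_horner.
    exact/cvg_at_right_filter/continuous_horner.
  exact/cvg_at_left_filter/continuous_horner.
- exact: continuous_subspaceT.
rewrite -[fine _]/(\int[mu]_(x in `[a, b]) (f F.[x] / (b - a))) RintegralZr//.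
  by rewrite mulrC mulfVK//; apply: eq_Rintegral => x _; rewrite FE.
apply: integrable_continuous_itv => x.
exact/continuous_comp/f_cont/continuous_horner.
Qed.

Lemma has_Rintegral_beta a b p q : a <= b ->
  has_Rintegral mu `[a, b] (fun x => (x - a) ^+ p * (b - x) ^+ q)
    ((p`! * q`!)%:R / (p + q).+1`!%:R * (b - a) ^+ (p + q).+1).
Proof.
move=> ab; set f := fun x => (x - a) ^+ p * _.
have f_int : mu.-integrable `[a, b] (EFin \o f).
  rewrite (_ : f = horner (('X - a%:P) ^+ p * (b%:P - 'X) ^+ q)).
    exact/integrable_continuous_itv/continuous_horner.
  by apply/funext => x; rewrite !hornerE.
split=> //; move: ab; rewrite le_eqVlt => /predU1P[<-|ab].
  by rewrite set_itv1 Rintegral_set1 subrr expr0n mulr0.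
have ba0 : b - a != 0 by rewrite subr_eq0 gt_eqF.
have fE x : XMonemX p q ((x - a) / (b - a)) = f x / (b - a) ^+ (p + q).
  rewrite /XMonemX -[X in _ * X ^+ q]/(1 - _).
  have -> : 1 - (x - a) / (b - a) = (b - x) / (b - a) by field.
  by rewrite !exprMn !exprVn exprD invfM mulrACA.
rewrite -beta_fun_fact /beta_fun -Rintegral_mkcond exprS mulrCA mulrA.
rewrite -Rintegral_affine//; last exact: continuous_XMonemX.
under [in RHS]eq_Rintegral do rewrite fE.
by rewrite RintegralZr// mulfVK// expf_neq0.
Qed.

End HasRintegralInterval.

Section IteratedIntegral.
Context {R : realType}.
Implicit Types (f g : (nat -> R) -> R) (u : nat -> R) (v w : R).
Local Notation mu := (@lebesgue_measure R).

Definition unit_cube : set (nat -> R) := [set u | forall j, 0 <= u j <= 1].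

Definition scons (x : R) u : nat -> R :=
  fun j => if j is j'.+1 then u j' else x.

(* Integrability is required at every stage, so that [has_iint] is linear in
   the integrand while [iint], which has junk values, is not. The innermost
   variable of [iint] is coordinate 0, hence [scons]. *)
Fixpoint has_iint n f v : Prop :=
  if n is n'.+1 then
    exists2 g, {in unit_cube, forall u,
        has_Rintegral mu `[0, 1] (fun x => f (scons x u)) (g u)}
      & has_iint n' g v
  else f (fun=> 0) = v.

Lemma eq_iint n f g : {in unit_cube, f =1 g} -> iint n f = iint n g.
Proof.
elim: n f g => [|n IH] f g fg /=.
  by apply: fg; rewrite inE => j; rewrite lexx ler01.
apply: eq_Rintegral => x; rewrite inE /= in_itv /= => x01; apply: IH => u.
by rewrite inE => u01; apply: fg; rewrite inE => j; case: ifP.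
Qed.

Lemma iintS_innermost n f :
  iint n.+1 f = iint n (fun u => \int[mu]_(x in `[0, 1]) f (scons x u)).
Proof.
elim: n f => [|n IH] f.
  by congr Rintegral; apply/funext => x /=; congr f; apply/funext => -[].
transitivity (\int[mu]_(y in `[0, 1])
    iint n.+1 (fun u => f (fun j => if j == n.+1 then y else u j))).
  by [].
congr Rintegral; apply/funext => y; rewrite IH; congr iint; apply/funext => u.
by congr Rintegral; apply/funext => x; congr f; apply/funext => -[].
Qed.

Lemma has_iint_iint n f v : has_iint n f v -> iint n f = v.
Proof.
elim: n f => [//|n IH] f [g fg /IH <-]; rewrite iintS_innermost.
by apply: eq_iint => u /fg[].
Qed.

Lemma has_iint0 n : has_iint n (fun=> 0) 0.
Proof.
by elim: n => [//|n IH]; exists (fun=> 0) => // u _; apply: has_Rintegral0.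
Qed.

Lemma has_iintZ n k f v :
  has_iint n f v -> has_iint n (fun u => k * f u) (k * v).
Proof.
elim: n f => [f <-//|n IH] f [g fg gv].
exists (fun u => k * g u); last exact: IH.
by move=> u u01; apply: has_RintegralZ => //; apply: fg.
Qed.

Lemma has_iintD n f g v w :
  has_iint n f v -> has_iint n g w -> has_iint n (fun u => f u + g u) (v + w).
Proof.
elim: n f g => [f g <- <-//|n IH] f g [f' ff' f'v] [g' gg' g'w].
exists (fun u => f' u + g' u); last exact: IH.
by move=> u u01; apply: has_RintegralD => //; [apply: ff'|apply: gg'].
Qed.

Lemma has_iint_sum n (I : eqType) (r : seq I) (F : I -> (nat -> R) -> R)
    (V : I -> R) :
  {in r, forall i, has_iint n (F i) (V i)} ->
  has_iint n (fun u => \sum_(i <- r) F i u) (\sum_(i <- r) V i).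
Proof.
elim: r => [|i r IH] FV.
  by rewrite big_nil; under eq_fun do rewrite big_nil; apply: has_iint0.
rewrite big_cons; under eq_fun do rewrite big_cons.
apply: has_iintD; first by apply: FV; rewrite mem_head.
by apply: IH => j jr; apply: FV; rewrite inE jr orbT.
Qed.

End IteratedIntegral.

Section DirichletIntegral.
Context {R : realType}.
Implicit Types (lo : R) (s : seq R) (c : seq nat).
Local Notation mu := (@lebesgue_measure R).

Fixpoint gap_prod lo s c : R :=
  if s is y :: s' then (y - lo) ^+ head 0%N c * gap_prod y s' (behead c)
  else (1 - lo) ^+ head 0%N c.

Lemma gap_prodE lo s c : gap_prod lo s c = \prod_(l < (size s).+1)
  (nth 0 (rcons s 1) l - nth 0 (lo :: s) l) ^+ nth 0%N c l.
Proof.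
elim: s lo c => [|y s IH] lo c /=.
  by rewrite big_ord_recl big_ord0 mulr1 nth0.
rewrite IH [RHS]big_ord_recl nth0; congr (_ * _).
by apply: eq_bigr => l _; rewrite nth_behead.
Qed.

(* Integrating out the point that separates two adjacent gaps with exponents
   [k] and [l] leaves one gap with exponent [k + l + 1] and a beta factor. *)
Fixpoint merge_gaps c : seq (R * seq nat) :=
  if c is k :: c' then
    if c' is l :: c'' then
      ((k`! * l`!)%:R / (k + l).+1`!%:R, (k + l).+1 :: c'') ::
      [seq (p.1, k :: p.2) | p <- merge_gaps c']
    else [::]
  else [::].

Definition dirichlet_integral n c : R :=
  (n`! * \prod_(k <- c) k`!)%:R / (n + sumn c)`!%:R.

Lemma has_Rintegral_gap_prod lo s c :
  path <=%R lo (rcons s 1) -> size c = (size s).+2 ->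
  has_Rintegral mu `[lo, 1] (fun x => gap_prod lo (merge <=%R [:: x] s) c)
    (\sum_(p <- merge_gaps c) p.1 * gap_prod lo s p.2).
Proof.
elim: s lo c => [|y s IH] lo [|k [|l c]]//=.
  by case: c => // /andP[lo1 _] _; rewrite big_seq1; exact: has_Rintegral_beta.
move=> /andP[loy ys] [size_c].
have y1 : y <= 1.
  have /allP := order_path_min le_trans ys; apply.
  by rewrite mem_rcons mem_head.
rewrite big_cons big_map; apply: (has_Rintegral_itv_cat loy y1).
  rewrite /= mulrA [X in has_Rintegral _ _ _ X]mulrC.
  have := has_Rintegral_beta k l loy.
  move=> /(has_RintegralZ _ (gap_prod y s c))-/(_ (measurable_itv _)).
  apply: has_Rintegral_ext => // x.
  by rewrite inE /= in_itv /= => /andP[_ xy]; rewrite xy /=; ring.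
under eq_bigr do rewrite /= mulrCA.
rewrite -mulr_sumr; have := IH y (l :: c) ys; rewrite /= size_c => /(_ erefl).
move=> /(has_RintegralZ _ ((y - lo) ^+ k))-/(_ (measurable_itv _)).
apply: has_Rintegral_ext => // x.
rewrite inE /= in_itv /= => /andP[yx _]; case: ifP => // xy /=.
have -> : x = y by apply/le_anti; rewrite xy.
by case: s ys {IH size_c} => //= z s /andP[-> _].
Qed.

Lemma mem_merge_gaps c p : p \in merge_gaps c ->
  [/\ size c = (size p.2).+1, sumn p.2 = (sumn c).+1
    & p.1 * (\prod_(k <- p.2) k`!)%:R = (\prod_(k <- c) k`!)%:R].
Proof.
elim: c p => // k [|l c] IH p //; rewrite [merge_gaps _]/= inE.
case/predU1P => [->|/mapP[q /IH[size_q sum_q prod_q] ->]] /=.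
  split; rewrite ?addSn ?addnA// !big_cons mulnA !natrM mulrA mulfVK//.
  by rewrite -natrM -factS pnatr_eq0 -lt0n fact_gt0.
move: size_q sum_q => /= -> ->; split; rewrite ?addnS//.
by rewrite big_cons [in RHS]big_cons [in RHS]natrM -prod_q natrM mulrCA.
Qed.

Lemma size_merge_gaps c : size (merge_gaps c) = (size c).-1.
Proof. by elim: c => // k [|l c] //= IH; rewrite size_map IH. Qed.

Lemma sum_merge_gaps_dirichlet_integral n c : size c = n.+2 ->
  \sum_(p <- merge_gaps c) p.1 * dirichlet_integral n p.2 =
  dirichlet_integral n.+1 c.
Proof.
move=> size_c; rewrite (eq_big_seq (fun=> (n`! * \prod_(k <- c) k`!)%:R /
   (n.+1 + sumn c)`!%:R)); last first.
  move=> p /mem_merge_gaps[_ sum_p prod_p].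
  by rewrite /dirichlet_integral sum_p addSnnS mulrA natrM mulrCA prod_p natrM.
rewrite big_const_seq count_predT size_merge_gaps size_c iter_addr_0.
by rewrite -mulrnAl /dirichlet_integral -mulr_natl -natrM mulnA -factS.
Qed.

Lemma has_iint_dirichlet_integral n c : size c = n.+1 ->
  has_iint n (fun u => gap_prod 0 (sort <=%R [seq u i | i <- iota 0 n]) c)
    (dirichlet_integral n c).
Proof.
elim: n c => [|n IH] c size_c.
  case: c size_c => // k [|//] _.
  by rewrite /dirichlet_integral big_seq1 /= subr0 expr1n addn0 mul1n divff.
rewrite -sum_merge_gaps_dirichlet_integral//.
exists (fun u => \sum_(p <- merge_gaps c)
    p.1 * gap_prod 0 (sort <=%R [seq u i | i <- iota 0 n]) p.2); last first.
  apply: has_iint_sum => p /mem_merge_gaps[size_p _ _]; apply/has_iintZ/IH.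
  by apply/eq_add_S; rewrite -size_p.
move=> u; rewrite inE => u01; set s := sort _ _.
have s01 x : x \in s -> 0 <= x <= 1 by rewrite mem_sort => /mapP[j _ ->].
have s_path : path <=%R 0 (rcons s 1).
  rewrite rcons_path path_min_sorted ?sort_le_sorted//; last first.
    by apply/allP => x /s01/andP[].
  have := mem_last 0 s; rewrite inE => /predU1P[->|/s01/andP[]//].
  exact: ler01.
apply: has_Rintegral_ext (has_Rintegral_gap_prod s_path _) => //; last first.
  by rewrite size_c size_sort size_map size_iota.
move=> x _.
by rewrite -sort_cons [iota 0 n.+1]/= map_cons (iotaDl 1 0) -map_comp.
Qed.

End DirichletIntegral.

Section PnmRankings.
Context {R : realType} {n m : nat}.
Implicit Types (a : {ffun 'I_m -> 'I_n.+1}) (E : ('I_m -> R) -> Prop).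

Definition level_counts a : seq nat :=
  [seq #|[pred i | a i == l]| | l <- enum 'I_n.+1].

Definition level_pval a : 'I_m -> R := fun i => (a i).+1%:R / n.+1%:R.

Lemma prod_PUmass (u : nat -> R) a :
  \prod_i PUmass (fun i : 'I_n => u i) (a i).+1 =
  gap_prod 0 (sort <=%R [seq u i | i <- iota 0 n]) (level_counts a).
Proof.
rewrite (partition_big a xpredT)//= gap_prodE size_sort size_map size_iota.
apply: eq_bigr => l _.
rewrite (eq_bigr (fun=> PUmass (fun i : 'I_n => u i) l.+1)) => [|i /eqP-> //].
rewrite prodr_const (nth_map ord0) ?size_enum_ord// nth_ord_enum.
congr (_ ^+ _).
rewrite /PUmass /ustat /ordstat /= eqSS.
have -> : [seq u i | i : 'I_n <- enum 'I_n] = [seq u i | i <- iota 0 n].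
  by rewrite -val_enum_ord -map_comp.
rewrite nth_rcons size_sort size_map size_iota; congr (_ - _).
  have [->|ln] := eqVneq (l : nat) n; first by rewrite ltnn.
  by rewrite ltn_neqAle ln -ltnS ltn_ord.
by case: l => -[|l] //= ln; rewrite ltn_eqF// ltnW.
Qed.

Lemma sumn_level_counts a : sumn (level_counts a) = m.
Proof.
rewrite sumnE big_map big_enum /= -[RHS]card_ord -sum1_card.
by rewrite (partition_big a xpredT)//=; apply: eq_bigr => l _; rewrite sum1_card.
Qed.

Lemma dirichlet_integral_level_counts a : dirichlet_integral n (level_counts a) =
  (count (fun s => ranking_levels s == a) (rankings (n + m)))%:R
    / (n + m)`!%:R :> R.
Proof.
rewrite /dirichlet_integral sumn_level_counts count_ranking_levels.
by rewrite big_map big_enum.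
Qed.

Lemma Pnm_rankings E : Pnm n E =
  (count (fun s => `[< E (level_pval (ranking_levels s)) >])
     (rankings (n + m)))%:R / (n + m)`!%:R.
Proof.
transitivity (\sum_a (if `[< E (level_pval a) >] then 1 else 0 : R) *
    dirichlet_integral n (level_counts a)).
  apply/has_iint_iint/has_iint_sum => a _.
  under eq_fun do rewrite mulrC prod_PUmass.
  apply/has_iintZ/has_iint_dirichlet_integral.
  by rewrite size_map size_enum_ord.
rewrite -sum1_count.
rewrite (partition_big ranking_levels (fun a => `[< E (level_pval a) >]))//=.
rewrite natr_sum mulr_suml [RHS]big_mkcond; apply: eq_bigr => a _.
case: asboolP => Ea; rewrite ?mul0r ?mul1r//.
rewrite dirichlet_integral_level_counts -sum1_count.
congr (_%:R / _); apply: eq_bigl => s.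
by apply/idP/andP => [/eqP sa|[]//]; rewrite sa; split => //; apply/asboolP.
Qed.

End PnmRankings.

Section TupleMeasure.
Context {d : measure_display} {T : measurableType d} {R : realType} {N : nat}.

Definition boxes : set_system (N.-tuple T) :=
  [set A | exists2 B : 'I_N -> set T, (forall i, measurable (B i))
    & A = [set x | forall i, B i (tnth x i)]].

Lemma setI_closed_boxes : setI_closed boxes.
Proof.
move=> _ _ [A mA ->] [B mB ->]; exists (fun i => A i `&` B i).
  by move=> i; apply: measurableI.
apply/seteqP; split => x /=; first by move=> [Ax Bx] i.
by move=> ABx; split => i; case: (ABx i).
Qed.

Lemma measurable_tuple_boxes : measurable = <<s boxes >>.
Proof.
apply/seteqP; split => [C mC|].
  suff : measurable_fun setT (id : g_sigma_algebraType boxes -> N.-tuple T).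
    by move=> /(_ measurableT C mC); rewrite setTI.
  apply/measurable_fun_tnthP => i _ A mA; rewrite setTI.
  apply: sub_sigma_algebra; exists (fun j => if j == i then A else setT).
    by move=> j; case: ifP.
  apply/seteqP; split => x /=; last by move/(_ i); rewrite eqxx.
  by move=> Ax j; case: eqP => // ->.
apply: smallest_sub; first exact: sigma_algebra_measurable.
move=> _ [B mB ->].
rewrite (_ : mkset _ =
    \bigcap_(i in [set: 'I_N]) (fun x => tnth x i) @^-1` B i); last first.
  by apply/seteqP; split => x /= h i; [move=> _|]; apply: h.
apply: fin_bigcap_measurable => [|i _]; first exact: finite_finset.
by rewrite -[X in measurable X]setTI; apply: measurable_tnth.
Qed.

Lemma eq_probability_boxes (P Q : probability (N.-tuple T) R) :
  (forall A, boxes A -> P A = Q A) -> forall A, measurable A -> P A = Q A.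
Proof.
move=> PQ; apply: (measure_unique boxes (fun=> setT)) => //.
- exact: measurable_tuple_boxes.
- exact: setI_closed_boxes.
- by move=> _; exists (fun=> setT) => //; apply/seteqP.
- by rewrite bigcup_const.
- by move=> _; rewrite -[X in (X < _)%E]/(P setT) probability_setT ltry.
Qed.

End TupleMeasure.

Lemma measurable_comparisons (R : realType) (d : measure_display)
    (T : measurableType d) (J : finType) (X : J -> T -> R) (A : set T) :
  (forall i, measurable_fun setT (X i)) ->
  (forall w w', (forall i j, (X i w <= X j w) = (X i w' <= X j w')) ->
    A w -> A w') ->
  measurable A.
Proof.
move=> mX A_inv; pose cmp w := [ffun ij : J * J => X ij.1 w <= X ij.2 w].
rewrite (_ : A = \bigcup_(b in cmp @` A) \bigcap_(ij in [set: J * J])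
    [set w | (X ij.1 w <= X ij.2 w) = b ij]).
  apply: fin_bigcup_measurable => [|b _]; first exact: finite_finset.
  apply: fin_bigcap_measurable => [|ij _]; first exact: finite_finset.
  have := measurable_fun_ler (mX ij.1) (mX ij.2) measurableT (Y := [set b ij]).
  by rewrite setTI; apply.
apply/seteqP; split => [w Aw|w [_ [w' Aw' <-] w_cmp]].
  by exists (cmp w) => [|ij _ /=]; [exists w|rewrite ffunE].
by apply: A_inv Aw' => i j; have /= -> := w_cmp (i, j) I; rewrite ffunE.
Qed.

Section Exchangeable.
Context {R : realType} {d : measure_display} {T : measurableType d}.
Context (P : probability T R) {N : nat} (X : 'I_N -> T -> R).
Implicit Types (s : seq 'I_N) (A : set T).

Definition exchangeable : Prop :=
  forall (sigma : 'S_N) (B : 'I_N -> set R), (forall i, measurable (B i)) ->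
    P [set w | forall i, B i (X (sigma i) w)] =
    P [set w | forall i, B i (X i w)].

Definition ranked s : set T := [set w | sorted (fun i j => X j w < X i w) s].

Hypothesis mX : forall i, measurable_fun setT (X i).

Lemma measurable_ranked s : measurable (ranked s).
Proof.
apply: (measurable_comparisons mX) => w w' ww'; rewrite /ranked /=.
by apply: etrans; apply: eq_sorted => i j; rewrite !ltNge ww'.
Qed.

Lemma trivIset_ranked : trivIset [set` rankings N] ranked.
Proof.
move=> s s' /= s_rank s'_rank [w [ws ws']].
apply: (irr_sorted_eq (leT := fun i j => X j w < X i w)) => //.
- by move=> i j k ij ki; apply: lt_trans ki ij.
- exact/perm_mem/perm_rankings.
Qed.

Lemma ranked_exists w :
  injective (X^~ w) -> exists2 s, s \in rankings N & ranked s w.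
Proof.
move=> X_inj; pose s := sort (fun i j => X j w <= X i w) (enum 'I_N).
exists s; first by rewrite mem_permutations perm_sort.
rewrite /ranked /= (sorted_gt_uniq_ge (X^~ w)).
rewrite map_inj_uniq// sort_uniq enum_uniq /=.
by apply: sort_sorted => i j; apply: le_total.
Qed.

Hypothesis exchX : exchangeable.

Lemma exchangeable_tuple (sigma : 'S_N) (C : set (N.-tuple R)) : measurable C ->
  P [set w | C [tuple X (sigma i) w | i < N]] =
  P [set w | C [tuple X i w | i < N]].
Proof.
have mtuple (Y : 'I_N -> T -> R) : (forall i, measurable_fun setT (Y i)) ->
    measurable_fun setT (fun w => [tuple Y i w | i < N]).
  move=> mY; apply/measurable_fun_tnthP => i.
  by rewrite (_ : _ \o _ = Y i)//; apply/funext => w /=; rewrite tnth_mktuple.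
pose Xt : {mfun T >-> N.-tuple R} := mfun_Sub (mem_set (mtuple _ mX)).
pose Xsigma : {mfun T >-> N.-tuple R} :=
  mfun_Sub (mem_set (mtuple _ (fun i => mX (sigma i)))).
apply: (eq_probability_boxes (P := distribution P Xsigma)
  (Q := distribution P Xt)).
have boxE (B : 'I_N -> set R) (Y : 'I_N -> T -> R) :
    [set w | forall i, B i (tnth [tuple Y i w | i < N] i)] =
    [set w | forall i, B i (Y i w)].
  by apply/seteqP; split => w /= BY i; have := BY i; rewrite tnth_mktuple.
move=> _ [B mB ->]; have := exchX sigma mB.
by rewrite -(boxE B (fun i => X (sigma i))) -(boxE B X).
Qed.

Lemma prob_ranked_exchangeable s :
  s \in rankings N -> P (ranked s) = P (ranked (enum 'I_N)).
Proof.
rewrite mem_permutations -val_ord_tuple => /tuple_permP[sigma ->].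
pose C : set (N.-tuple R) :=
  [set x | sorted (fun i j => tnth x j < tnth x i) (enum 'I_N)].
have CE (Y : 'I_N -> T -> R) : [set w | C [tuple Y i w | i < N]] =
    [set w | sorted (fun i j => Y j w < Y i w) (enum 'I_N)].
  apply/funext => w /=; congr is_true; apply: eq_sorted => i j.
  by rewrite !tnth_mktuple.
have mC : measurable C.
  apply: (measurable_comparisons (X := fun i (x : N.-tuple R) => tnth x i)).
    exact: measurable_tnth.
  move=> x y xy; rewrite /C /=.
  by apply: etrans; apply: eq_sorted => i j; rewrite !ltNge xy.
have := exchangeable_tuple sigma mC.
rewrite (CE (fun i => X (sigma i))) (CE X) val_ord_tuple => <-.
congr (P _); apply/funext => w; rewrite /ranked /= sorted_map.
by congr is_true; apply: eq_sorted => i j /=; rewrite !tnth_ord_tuple.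
Qed.

Hypothesis X_noties : P [set w | exists i j, i != j /\ X i w = X j w] = 0%E.

Lemma sum_prob_ranked A : measurable A ->
  P A = (\sum_(s <- rankings N) P (A `&` ranked s))%E.
Proof.
move=> mA; pose U := \bigcup_(s in [set` rankings N]) ranked s.
have mU : measurable U.
  apply: fin_bigcup_measurable => [|s _]; first exact: finite_seq.
  exact: measurable_ranked.
have PAU : P (A `\` U) = 0%E.
  apply: subset_measure0 X_noties; first exact: measurableD.
    apply: (measurable_comparisons mX) => w w' ww' [i [j [ij Xij]]].
    by exists i, j; split=> //; apply/le_anti; rewrite -!ww' Xij lexx.
  move=> w [_]; apply: contra_notP => no_tie.
  have [i j Xij|s s_rank ws] := @ranked_exists w.
    by apply/eqP; apply: contra_notT no_tie => ij; exists i, j.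
  by exists s.
rewrite (measureDI P mA mU) [X in (X + _)%E]PAU add0e setI_bigcupr.
rewrite measure_fin_bigcup//.
- by rewrite -fsbig_seq ?permutations_uniq.
- exact: finite_seq.
- exact/trivIset_setIl/trivIset_ranked.
- by move=> s _; apply: measurableI => //; apply: measurable_ranked.
Qed.

Lemma prob_ranked s : s \in rankings N -> P (ranked s) = (N`!%:R^-1)%:E.
Proof.
have factN0 : N`!%:R != 0 :> R by rewrite pnatr_eq0 -lt0n fact_gt0.
move=> /prob_ranked_exchangeable ->.
have := sum_prob_ranked measurableT; rewrite probability_setT.
under eq_big_seq => u u_rank do rewrite setTI prob_ranked_exchangeable//.
rewrite -(fineK (fin_num_measure P _ (measurable_ranked _))) sumEFin => -[].
rewrite big_const_seq count_predT size_permutations ?enum_uniq//.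
rewrite size_enum_ord iter_addr_0 => N_prob; congr EFin.
by apply: (mulIf factN0); rewrite mulVf// mulr_natr -N_prob.
Qed.

Lemma prob_ranking_event (Q : pred (seq 'I_N)) A : measurable A ->
  (forall s w, s \in rankings N -> ranked s w -> A w <-> Q s) ->
  P A = ((count Q (rankings N))%:R / N`!%:R)%:E.
Proof.
move=> mA AQ; rewrite sum_prob_ranked//.
rewrite (eq_big_seq (fun s => if Q s then (N`!%:R^-1)%:E else 0%E)).
  by rewrite -big_mkcond sumEFin big_const_seq iter_addr_0 mulr_natl.
move=> s s_rank; case: ifPn => [Qs|/negP nQs].
  by rewrite setIidr ?prob_ranked// => w ws; apply/(AQ s).
rewrite (_ : _ `&` _ = set0) ?measure0// -subset0 => w [Aw ws].
by apply/nQs/(AQ s w).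
Qed.

End Exchangeable.

Section PvalLaw.
Context {R : realType} {n m : nat}.
Implicit Types (x y : 'I_(n + m) -> R) (E : ('I_m -> R) -> Prop).

Lemma card_mkset (I : finType) (p : pred I) : #|[set i | p i]| = #|p|.
Proof. by apply: eq_card => i; apply/idP/idP; rewrite inE. Qed.

Lemma eq_pval x y :
  (forall i j, (x i <= x j) = (y i <= y j)) -> Defs.pval x = Defs.pval y.
Proof.
move=> xy; apply/funext => i; rewrite /Defs.pval !card_mkset.
by congr ((1 + _%:R) / _); apply: eq_card => j; apply: xy.
Qed.

Lemma pval_ranking x s :
  s \in rankings (n + m) -> sorted (fun i j => x j < x i) s ->
  Defs.pval x = level_pval (ranking_levels s).
Proof.
move=> s_rank x_decr; apply/funext => i; rewrite /Defs.pval nat1r card_mkset.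
rewrite /level_pval (ranking_levels_decreasing s_rank (f := x))//.
  by apply: sub_sorted x_decr => j k; exact: ltW.
by move=> j; rewrite (inj_eq (decreasing_ranking_inj s_rank x_decr)) eq_lrshift.
Qed.

Context {d : measure_display} {T : measurableType d} (P : probability T R).
Context (S : 'I_(n + m) -> T -> R).
Hypothesis mS : forall i, measurable_fun setT (S i).

Lemma measurable_pval E : measurable [set w | E (Defs.pval (S^~ w))].
Proof. by apply: (measurable_comparisons mS) => w w' /eq_pval /= ->. Qed.

Hypothesis exchS : exchangeable P S.
Hypothesis noties : P [set w | exists i j, i != j /\ S i w = S j w] = 0%E.

Lemma pval_law E : P [set w | E (Defs.pval (S^~ w))] = (Pnm n E)%:E.
Proof.
rewrite Pnm_rankings; apply: prob_ranking_event => //.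
  exact: measurable_pval.
move=> s w s_rank ws /=; rewrite (pval_ranking s_rank ws).
by split => /asboolP.
Qed.

End PvalLaw.

Section OrderStatistics.
Context {R : realType}.
Implicit Types (t : R -> R) (lam x y : R).

Lemma lt_ordstat_card N (q : 'I_N -> R) k y : (0 < k <= N)%N ->
  y < ordstat q k -> (#|[pred i | (q i <= y)%R]| < k)%N.
Proof.
move=> /andP[k0 kN]; apply: contraTltn => k_card; rewrite -leNgt.
apply: nth_count_le; first exact: sort_le_sorted.
by rewrite count_sort prednK// count_map -sum1_count big_enum_cond /= sum1_card.
Qed.

Lemma tinv_ge0 t x : 0 <= tinv t x.
Proof.
rewrite /tinv; set A := mkset _.
have [->|/set0P[l Al]] := eqVneq A set0; first by rewrite sup0.
case: (Al) => /andP[l0 _] _; apply: le_trans l0 _; apply: ub_le_sup => //.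
by exists 1 => y [/andP[]].
Qed.

Lemma lt_tinv t lam x :
  template_fun t -> 0 <= lam -> lam < tinv t x -> t lam < x.
Proof.
move=> [_ _ incr] lam0; rewrite /tinv; set A := mkset _ => lam_sup.
have [A0|/set0P A0] := eqVneq A set0.
  by move: lam_sup; rewrite A0 sup0 ltNge lam0.
have [l [/andP[l0 l1] tl] laml] := sup_gt A0 lam_sup.
apply: lt_le_trans tl; apply: incr => //; rewrite in_itv /= ?lam0 ?l0 ?l1//.
by rewrite (le_trans (ltW laml)).
Qed.

Lemma finite_set_mem_sup (A : set R) : finite_set A -> A !=set0 -> A (sup A).
Proof.
move=> /finite_compact cA A0; have [_ ubA] := compact_has_sup A0 cA.
rewrite [X in X _](iffLR (closure_id A) (compact_closed (@Rhausdorff R) cA)).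
exact: closure_sup.
Qed.

Lemma finite_Lambda n m (K : {set 'I_m.+1}) (t : 'I_m.+1 -> R -> R) :
  finite_set (Lambda n K t).
Proof.
pose f (kl : 'I_m.+1 * 'I_n.+2) := tinv (t kl.1) (kl.2%:R / n.+1%:R).
apply: (@sub_finite_set _ _ (f @` setT)); last exact/finite_image/finite_finset.
move=> _ [k [l [_ [/andP[_ ln] ->]]]].
by exists (k, Ordinal (ln : (l < n.+2)%N)).
Qed.

End OrderStatistics.

Section Template.
Context {R : realType} {n m : nat} (K : {set 'I_m.+1}) (t : 'I_m.+1 -> R -> R).
Hypothesis K_gt0 : forall k, k \in K -> (0 < k)%N.
Hypothesis t_template : forall k, k \in K -> template_fun (t k).
Implicit Types (s : 'I_(n + m) -> R) (lam delta : R).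

Lemma pval_gt0 s i : 0 < Defs.pval s i.
Proof. by rewrite /Defs.pval divr_gt0 ?ltr0n// ltr_pwDl. Qed.

Lemma Fhat0 s : Fhat s 0 = 0.
Proof.
rewrite /Fhat card_mkset eq_card0 ?mul0r// => i.
by apply/negbTE; rewrite -topredE /= -ltNge pval_gt0.
Qed.

Lemma minevent_Fhat s lam : 0 <= lam -> minevent K t lam (Defs.pval s) ->
  forall k, k \in K -> Fhat s (t k lam) <= k%:R / m%:R.
Proof.
move=> lam0 min_s k kK; rewrite /Fhat ler_wpM2r ?invr_ge0//.
rewrite ler_nat card_mkset ltnW//; apply: lt_ordstat_card.
  by rewrite K_gt0// -ltnS ltn_ord.
exact/(lt_tinv (t_template kK))/min_s.
Qed.

Lemma lamselP delta : lamsel n K t delta = 0 \/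
  0 <= lamsel n K t delta /\
  1 - delta <= Pnm n (minevent K t (lamsel n K t delta)).
Proof.
rewrite /lamsel; set A := (X in `[< X !=set0 >]).
case: asboolP => [A0|_]; last by left.
have [[k [l [_ [_ lamE]]]] lam_prob] : A (sup A).
  apply: finite_set_mem_sup => //.
  by apply: sub_finite_set (finite_Lambda n K t) => x [].
by right; split => //; rewrite lamE tinv_ge0.
Qed.

End Template.

Theorem theorem3 (R : realType) (d : measure_display) (T : measurableType d)
  (P : probability T R) (n m : nat) (S : 'I_(n + m) -> T -> R)
  (K : {set 'I_m.+1}) (t : 'I_m.+1 -> R -> R) (delta : R) :
  (1 <= n)%N -> (1 <= m)%N ->
  (forall i, measurable_fun setT (S i)) ->
  (* exchangeability: the joint law is invariant under permutations *)
  (forall (sigma : 'S_(n + m)) (B : 'I_(n + m) -> set R),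
      (forall i, measurable (B i)) ->
      P [set w | forall i, B i (S (sigma i) w)] = P [set w | forall i, B i (S i w)]) ->
  (* almost surely no ties *)
  P [set w | exists i j, i != j /\ S i w = S j w] = 0%E ->
  (* K is a subset of {1,...,m} *)
  (forall k, k \in K -> (0 < k)%N) ->
  (* template *)
  (forall k, k \in K -> template_fun (t k)) ->
  0 < delta < 1 ->
  ((1 - delta)%:E <=
     P [set w | forall k, k \in K ->
          (Fhat (fun i => S i w) (t k (lamsel n K t delta)) <= (nat_of_ord k)%:R / m%:R)%R])%E.
Proof.
move=> _ _ mS exchS noties K_gt0 t_template /andP[delta0 _].
set lam := lamsel n K t delta.
have [lamE|[lam0 lam_prob]] := lamselP (n := n) K t delta.
  rewrite {}/lam lamE (_ : mkset _ = setT).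
    by rewrite probability_setT lee_fin gerBl ltW.
  apply/seteqP; split => // w _ k kK /=.
  by have [-> _ _] := t_template k kK; rewrite Fhat0 divr_ge0.
apply: (@le_trans _ _ (P [set w | minevent K t lam (Defs.pval (S^~ w))])).
  by rewrite (pval_law mS exchS noties) lee_fin.
apply: le_measure; rewrite ?inE.
- exact: measurable_pval.
- exact: (measurable_pval mS (fun q => forall k, k \in K ->
    #|[set i | (q i <= t k lam)%R]|%:R / m%:R <= k%:R / m%:R)).
- by move=> w; apply: minevent_Fhat.
Qed.
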